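(* Let $q$ be a prime power and let $\mathcal{A}$ be a maximal $(n,d)$-arc in the Desarguesian projective plane $\mathrm{PG}(2,q)$. Let $\mathcal{D}$ be the $2$-$(n,d,1)$ design obtained from $\mathcal{A}$, that is, the design whose points are the points of $\mathcal{A}$ and whose blocks are the intersections $\ell\cap\mathcal{A}$ of $\mathcal{A}$ with its secant lines $\ell$. Then the largest intersecting families of blocks in $\mathcal{D}$ are the canonical ones; that is, a set $Y$ of blocks of $\mathcal{D}$ is an intersecting family of maximum size if and only if there is a point $P\in\mathcal{A}$ such that $Y$ is the set of all blocks of $\mathcal{D}$ containing $P$.
   Context: $\mathrm{PG}(2,q)$ is the projective plane over the finite field $\mathbb{F}_q$. An $(n,d)$-arc ($n,d>1$) in a finite projective plane of order $q$ is a set $\mathcal{A}$ of $n$ points such that each line meets $\mathcal{A}$ in at most $d$ points and at least one line meets $\mathcal{A}$ in exactly $d$ points. Always $n\le 1+(q+1)(d-1)$; if equality holds, $\mathcal{A}$ is called a maximal arc, and then each line meets $\mathcal{A}$ in $0$ or $d$ points. Lines meeting $\mathcal{A}$ in $d$ points are called secants of $\mathcal{A}$. A $2$-$(v,k,1)$ design is a collection of $k$-subsets (blocks) of a $v$-set of points such that every pair of distinct points is contained in exactly one block. Throughout, projective planes are excluded as designs: only designs with $v>k^2-k+1$, equivalently $v\ge k^2$, are considered (for the design obtained from a maximal $(n,d)$-arc in $\mathrm{PG}(2,q)$ this means $d\neq q+1$). An intersecting family of blocks is a set $Y$ of blocks such that any two distinct blocks in $Y$ have exactly one point in common. An intersecting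 family is called canonical if it consists of all blocks containing some fixed point of the design.
   Formalization: For d = q the design is the affine plane AG(2,q), where one line from each parallel class can give a non-canonical maximum intersecting family; so ''maximum size implies canonical'' is asserted only for d ≠ q, while canonical families are shown maximum for all d ≠ q+1. *)

(* Defs.v *)
(* Library: Mathematical Components. *)
From HB Require Import structures.
From mathcomp Require Import all_boot all_order all_algebra.

Set Implicit Arguments.
Unset Strict Implicit.
Unset Printing Implicit Defensive.

(* The points and lines of PG(2,F) are the subspaces of F^3 of vector space
   dimension 1 and 2; incidence is inclusion of subspaces. *)
Record pg_flat (F : finFieldType) (k : nat) := PGFlat {
  flat_space :> {vspace 'rV[F]_3};
  flat_dim : \dim flat_space == k }.

HB.instance Definition _ (F : finFieldType) (k : nat) :=
  [isSub for @flat_space F k].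
HB.instance Definition _ (F : finFieldType) (k : nat) :=
  [Choice of pg_flat F k by <:].

(* The library has no finType structure on {vspace _}; a subspace of F^3 is
   determined by its finite set of vectors. *)
Definition flat_vectors (F : finFieldType) (k : nat) (U : pg_flat F k) :
    {set 'rV[F]_3} :=
  [set v | v \in flat_space U].
Definition vectors_flat (F : finFieldType) (k : nat) (S : {set 'rV[F]_3}) :
    option (pg_flat F k) :=
  insub <<enum S>>%VS.
Lemma flat_vectorsK (F : finFieldType) (k : nat) :
  pcancel (@flat_vectors F k) (@vectors_flat F k).
Proof.
move=> U; rewrite /vectors_flat.
suff -> : <<enum (flat_vectors U)>>%VS = flat_space U by rewrite valK.
apply/eqP; rewrite eqEsubv; apply/andP; split.
  by apply/span_subvP => v; rewrite mem_enum inE.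
by apply/subvP => v Uv; apply: memv_span; rewrite mem_enum inE.
Qed.

HB.instance Definition _ (F : finFieldType) (k : nat) :=
  PCanIsCountable (@flat_vectorsK F k).
HB.instance Definition _ (F : finFieldType) (k : nat) : isFinite (pg_flat F k) :=
  PCanIsFinite (@flat_vectorsK F k).

Notation pg_point F := (pg_flat F 1).
Notation pg_line F := (pg_flat F 2).

Definition line_points (F : finFieldType) (l : pg_line F) : {set pg_point F} :=
  [set P : pg_point F | (P <= l)%VS].

Definition is_arc (F : finFieldType) (A : {set pg_point F}) (n d : nat) : Prop :=
  [/\ 1 < n, 1 < d, #|A| = n,
      forall l : pg_line F, #|line_points l :&: A| <= d
    & exists l : pg_line F, #|line_points l :&: A| = d].

Definition is_maximal_arc (F : finFieldType) (A : {set pg_point F})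
    (n d : nat) : Prop :=
  is_arc A n d /\ n = 1 + (#|F| + 1) * (d - 1).

Definition is_secant (F : finFieldType) (A : {set pg_point F}) (d : nat)
    (l : pg_line F) : bool :=
  #|line_points l :&: A| == d.

(* Block set of the design carried by A; its point set is A. *)
Definition arc_blocks (F : finFieldType) (A : {set pg_point F}) (d : nat) :
    {set {set pg_point F}} :=
  [set line_points l :&: A | l : pg_line F & is_secant A d l].

Definition intersecting_family (T : finType) (D Y : {set {set T}}) : Prop :=
  Y \subset D /\
  {in Y &, forall B C : {set T}, B != C -> #|B :&: C| = 1}.

Definition maximum_intersecting_family (T : finType)
    (D Y : {set {set T}}) : Prop :=
  intersecting_family D Y /\
  forall Z : {set {set T}}, intersecting_family D Z -> #|Z| <= #|Y|.

Definition blocks_through (T : finType) (D : {set {set T}}) (P : T) :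
    {set {set T}} :=
  [set B in D | P \in B].

(* Main.v *)
Require Import Defs.
From HB Require Import structures.
From mathcomp Require Import all_boot all_order all_algebra all_field.
From mathcomp Require Import zify ring.

(** Write q for the order of the field.  Counting on the pencil of lines
    through a point of the arc A shows that every line meeting A is a secant
    ([maximal_arc_secant]), so a point of A lies on q + 1 blocks; counting on
    the pencil of a point outside A shows that such a point lies on q / d
    external lines ([card_external_through]).

    An intersecting family is the trace on A of a set W of secants, any two of
    which meet inside A.  If e is an external line, the lines of W meet e in
    distinct points, since these points are outside A.  Hence #|W| <= q + 1
    ([meet_in_card]), which makes the canonical families maximum.  If equality
    holds, W covers every point of e ([meet_in_cover]).

    Suppose that #|W| = q + 1. If W covers the whole plane, counting on a line
    through the common point of two members of W shows that W is a pencil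
    ([covering_pencil]). Otherwise some point P is on no line of W, and then
    on no external line either. The lines that avoid P form an affine plane,
    namely the dual projective plane minus the line that P becomes there;
    parallel differences in it express concurrency ([affine_chart]). There W
    is a set of q + 1 points, and every external line is a nucleus of W: each
    line of the dual plane through it meets W exactly once. By the argument of
    Blokhuis and Wilbrink there are at most q - 1 nuclei in the affine plane
    ([card_nuclei]). But for d < q there are more than q external lines
    ([card_external_lines]), as q / d >= 2 lets a second external line pass
    through each point of a given one.

    The bound on nuclei is where the plane must be Desarguesian.  Embed F * F
    in a domain as the polynomials a + b X.  At a nucleus x the differences
    x - b, for b in W, represent each of the q + 1 directions once, and their
    (q - 1)-st powers depend on the directions only.  The sum of these powers
    over all directions is zero because power sums of exponent below q - 1
    vanish in F.  Hence x is a root of the sum over b in W of (Y - b)^(q - 1),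
    a polynomial of degree q - 1 with leading coefficient q + 1 = 1. *)

Import GRing.Theory.

Set Implicit Arguments.
Unset Strict Implicit.
Unset Printing Implicit Defensive.

Local Open Scope ring_scope.

(** * Nuclei of q + 1 points in an affine plane *)

(** Translation by 1 permutes F, so it preserves the sum of all elements. *)
Lemma natr_card_finField (F : finFieldType) : #|F|%:R = 0 :> F.
Proof.
have /addrI : (\sum_(a : F) a) + #|F|%:R = (\sum_(a : F) a) + 0.
  rewrite addr0 -sumr_const -big_split /=.
  by rewrite [RHS](reindex_inj (addIr 1)).
by [].
Qed.

(** If k > 0, some nonzero g has g^k <> 1, since X^k - 1 has at most k roots;
    multiplying by g permutes F and multiplies the sum by g^k. *)
Lemma sum_powers_finField (F : finFieldType) (k : nat) :
  (k < #|F|.-1)%N -> \sum_(a : F) a ^+ k = 0.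
Proof.
case: k => [|k] ltk.
  by rewrite (eq_bigr (fun=> 1)) ?sumr_const ?natr_card_finField.
suff /existsP[g /andP[g0 gk]] : [exists g : F, (g != 0) && (g ^+ k.+1 != 1)].
  have inj_g : injective ( *%R g) by apply: mulfI.
  have eq_S : \sum_(a : F) a ^+ k.+1 = g ^+ k.+1 * \sum_(a : F) a ^+ k.+1.
    rewrite mulr_sumr [LHS](reindex_inj inj_g).
    by apply: eq_bigr => a _; rewrite exprMn.
  apply/eqP; apply: contraR gk => S0; apply/eqP/(mulIf S0).
  by rewrite -eq_S mul1r.
apply: contraLR ltk; rewrite negb_exists => /forallP gk.
rewrite -leqNgt -(cardC1 (0 : F)) cardE; apply: max_unity_roots (enum_uniq _).
  by [].
apply/allP => g; rewrite mem_enum inE => g0.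
by have := gk g; rewrite g0 /= negbK unity_rootE.
Qed.

(** An F-linear embedding of F * F in an integral domain.  Any domain that
    properly contains F would serve in place of {poly F}; the field of order q^2
    is the classical choice. *)
Definition affine_poly (F : finFieldType) (w : F * F) : {poly F} :=
  w.1%:P + w.2 *: 'X.

Lemma affine_poly_inj (F : finFieldType) : injective (@affine_poly F).
Proof.
move=> [a b] [a' b'] /polyP eqw.
have := eqw 0%N; have := eqw 1%N.
by rewrite /affine_poly !coefE /= !mulr0 !mulr1 !addr0 !add0r => -> ->.
Qed.

Lemma affine_polyB (F : finFieldType) (v w : F * F) :
  affine_poly (v - w) = affine_poly v - affine_poly w.
Proof. by rewrite /affine_poly polyCB scalerBl addrACA opprD. Qed.

(** In the binomial expansion of (a + b X)^(q - 1), the sum over a and b factors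
    into two power sums of exponents q - 1 - k and k, and one of these exponents
    is below q - 1. *)
Lemma sum_affine_poly (F : finFieldType) :
  \sum_(w : F * F) affine_poly w ^+ #|F|.-1 = 0.
Proof.
have q1 := finNzRing_gt1 F.
transitivity (\sum_(a : F) \sum_(b : F) affine_poly (a, b) ^+ #|F|.-1).
  by rewrite pair_big /=; apply: eq_bigr => -[a b].
under eq_bigr => a _.
  under eq_bigr => b _ do rewrite exprDn.
  rewrite exchange_big /=; over.
rewrite exchange_big big1 //= => k _.
set q1' := #|F|.-1.
transitivity ((((\sum_(a : F) a ^+ (q1' - k)) * (\sum_(b : F) b ^+ k)) *:
   'X^k) *+ 'C(q1', k)).
  rewrite mulr_suml scaler_suml -sumrMnl; apply: eq_bigr => a _.
  rewrite mulr_sumr scaler_suml -sumrMnl; apply: eq_bigr => b _.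
  by rewrite exprZn -rmorphXn mul_polyC scalerA.
(* Either k < q - 1, or k = q - 1 and the other exponent is 0 < q - 1. *)
have [ltk|gek] := ltnP k q1'.
  by rewrite (sum_powers_finField ltk) mulr0 scale0r mul0rn.
rewrite [X in X * _]sum_powers_finField ?mul0r ?scale0r ?mul0rn //.
have -> : (q1' - k = 0)%N by apply/eqP; rewrite subn_eq0.
by rewrite -ltnS prednK // (ltn_trans _ q1).
Qed.

(** When #|B| = q + 1 this says that every line through x meets B exactly once:
    distinct points of B lie in distinct ones of the q + 1 directions from x. *)
Definition nucleus (F : finFieldType) (B : {set F * F}) (x : F * F) : Prop :=
  x \notin B /\
  {in B &, forall b b' c, x.1 - b.1 = c * (x.1 - b'.1) ->
    x.2 - b.2 = c * (x.2 - b'.2) -> b = b'}.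

(** The nonzero vectors are the c (x - b) for b in B and c <> 0, each obtained
    once: distinct b give distinct directions, and there are
    (q + 1) (q - 1) = q^2 - 1 such pairs.  As c^(q - 1) = 1, the sum over all
    vectors is q - 1 = -1 times the sum over B. *)
Lemma sum_nucleus (F : finFieldType) (B : {set F * F}) (x : F * F) :
  #|B| = #|F|.+1 -> nucleus B x ->
  \sum_(b in B) affine_poly (x - b) ^+ #|F|.-1 = 0.
Proof.
move=> cardB [xB nucB].
have q1 := finNzRing_gt1 F.
have q0 : (0 < #|F|)%N by apply: ltn_trans q1.
pose h (bc : (F * F) * F) : F * F :=
  (bc.2 * (x.1 - bc.1.1), bc.2 * (x.2 - bc.1.2)).
pose D := setX B [set~ (0 : F)].
have inj_h : {in D &, injective h}.
  move=> [b c] [b' c'] /setXP[/= bB c0] /setXP[/= b'B c'0] [e1 e2].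
  rewrite !inE in c0 c'0.
  have eb : b = b'.
    apply: (nucB _ _ bB b'B (c^-1 * c')); rewrite -mulrA -?e1 -?e2 mulKf //.
  subst b'; congr pair.
  have [z|nz] := eqVneq (x.1 - b.1) 0; last exact: (mulIf nz).
  have [z'|nz] := eqVneq (x.2 - b.2) 0; last exact: (mulIf nz).
  case/negP: xB; suff -> : x = b by [].
  by case: (x) (b) z z' => [? ?] [? ?] /= /subr0_eq -> /subr0_eq ->.
have im_h : h @: D = [set~ (0, 0)].
  apply/eqP; rewrite eqEcard; apply/andP; split.
    apply/subsetP => _ /imsetP[[b c] /setXP[/= bB c0] ->].
    move: c0; rewrite !inE => c0.
    apply: contra xB => /eqP[/eqP e1 /eqP e2].
    move: e1 e2; rewrite !mulf_eq0 (negPf c0) /= !subr_eq0 => /eqP e1 /eqP e2.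
    by suff -> : x = b by []; case: (x) (b) e1 e2 => [? ?] [? ?] /= -> ->.
  rewrite card_in_imset // cardsX !cardsC1 cardB card_prod.
  by rewrite -[#|F|]prednK //=; lia.
have : \sum_(w in [set~ ((0, 0) : F * F)]) affine_poly w ^+ #|F|.-1 = 0.
  have := sum_affine_poly F; rewrite (bigD1 (0, 0)) //=.
  rewrite {1}/affine_poly scale0r addr0 polyC0 expr0n.
  rewrite -[_ == 0%N]negbK -lt0n -ltnS prednK // q1 /= add0r => S0.
  rewrite -[RHS]S0.
  by apply: eq_bigl => w; rewrite !inE.
rewrite -im_h big_imset //=.
rewrite (eq_bigl (fun bc => (bc.1 \in B) && (bc.2 \in [set~ 0]))); last first.
  by case=> b c; rewrite in_setX.
rewrite -(pair_big_dep (mem B) (fun=> mem [set~ 0])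
  (fun b c => affine_poly (c * (x.1 - b.1), c * (x.2 - b.2)) ^+ #|F|.-1)) /=.
under eq_bigr => b bB.
  have -> : \sum_(c in [set~ (0 : F)])
      affine_poly (c * (x.1 - b.1), c * (x.2 - b.2)) ^+ #|F|.-1
    = - affine_poly (x - b) ^+ #|F|.-1; last over.
  rewrite (eq_bigr (fun=> affine_poly (x - b) ^+ #|F|.-1)) => [|c].
    rewrite sumr_const cardsC1; apply/eqP; rewrite -addr_eq0 -mulrSr prednK //.
    by rewrite -mulr_natl -polyC_natr natr_card_finField mul0r.
  rewrite !inE => c0.
  have -> : affine_poly (c * (x.1 - b.1), c * (x.2 - b.2)) =
      c *: affine_poly (x - b).
    by rewrite /affine_poly /= scalerDr scalerA polyCM mul_polyC.
  by rewrite exprZn; have /(mulIf c0)-> : c ^+ #|F|.-1 * c = 1 * c;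
   rewrite ?scale1r // mul1r -exprSr prednK // expf_card.
by rewrite sumrN => /eqP; rewrite oppr_eq0 => /eqP.
Qed.

(** The nuclei are roots of a polynomial of degree q - 1 over {poly F}, which is
    nonzero because its coefficient of degree q - 1 is q + 1 = 1. *)
Lemma card_nuclei (F : finFieldType) (B N : {set F * F}) :
  #|B| = #|F|.+1 -> {in N, forall x, nucleus B x} -> (#|N| < #|F|)%N.
Proof.
move=> cardB nucN.
pose Phi : {poly {poly F}} :=
  \sum_(b in B) ('X - (affine_poly b)%:P) ^+ #|F|.-1.
have q0 : (0 < #|F|)%N by apply: ltn_trans (finNzRing_gt1 F).
have szPhi : (size Phi <= #|F|)%N.
  apply: (big_ind (fun p : {poly {poly F}} => size p <= #|F|)%N).
  - by rewrite size_poly0.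
  - by move=> p p' hp hp'; rewrite (leq_trans (size_polyD _ _)) // geq_max hp.
  - by move=> b _; rewrite size_exp_XsubC prednK.
have Phi_neq0 : Phi != 0.
  apply/eqP => /(congr1 (fun p : {poly {poly F}} => p`_(#|F|.-1))).
  rewrite coef0 coef_sum (eq_bigr (fun=> 1)) => [|b _].
    rewrite sumr_const cardB -polyC_natr mulrS natr_card_finField addr0.
    by apply/eqP; rewrite polyC_eq0 oner_eq0.
  have /monicP := monic_exp #|F|.-1 (monicXsubC (affine_poly b)).
  by rewrite lead_coefE size_exp_XsubC.
rewrite cardE -(size_map (@affine_poly F)).
apply: leq_trans szPhi; apply: max_poly_roots => //; last first.
  by rewrite map_inj_uniq ?enum_uniq //; apply: affine_poly_inj.
apply/allP => _ /mapP[x xN ->]; rewrite mem_enum in xN.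
rewrite rootE horner_sum -[X in _ == X](sum_nucleus cardB (nucN x xN)).
by apply/eqP/eq_bigr => b _; rewrite horner_exp !hornerE affine_polyB.
Qed.

(** * Incidence in PG(2,q) *)

Lemma dim_add_vlines (F : finFieldType) (u v : 'rV[F]_3) :
  u != 0 -> v \notin <[u]>%VS -> \dim (<[u]> + <[v]>)%VS = 2.
Proof.
move=> u0 uv; apply/eqP; rewrite eqn_leq; apply/andP; split.
  by rewrite (leq_trans (dimv_add_leqif _ _)) // !dim_vline leq_add ?leq_b1.
suff : (\dim <[u]> < \dim (<[u]> + <[v]>)%VS)%N by rewrite dim_vline u0.
rewrite (ltn_leqif (dimv_leqif_sup (addvSl _ _))).
apply: contra uv => sub.
by rewrite memvE (subv_trans (addvSr _ _) sub).
Qed.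

Lemma flat_eq (F : finFieldType) (k : nat) (U V : pg_flat F k) :
  (U <= V)%VS -> U = V.
Proof.
move=> UV; apply/val_inj/eqP.
by rewrite -(dimv_leqif_eq UV) /= (eqP (flat_dim U)) (eqP (flat_dim V)).
Qed.

Lemma point_of_vector (F : finFieldType) (v : 'rV[F]_3) :
  v != 0 -> exists P : pg_point F, flat_space P = <[v]>%VS.
Proof.
move=> v0; have dv : \dim <[v]> == 1 by rewrite dim_vline v0.
by exists (PGFlat dv).
Qed.

Lemma vector_of_point (F : finFieldType) (P : pg_point F) :
  exists2 v : 'rV[F]_3, v != 0 & flat_space P = <[v]>%VS.
Proof.
have P0 : vpick P != 0.
  by rewrite vpick0 -dimv_eq0 (eqP (flat_dim P)).
exists (vpick P) => //; have [Q eqQ] := point_of_vector P0.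
rewrite -eqQ; congr flat_space; apply/esym/flat_eq.
by rewrite eqQ -memvE memv_pick.
Qed.

Lemma dim_join (F : finFieldType) (P Q : pg_point F) :
  P != Q -> \dim (P + Q)%VS == 2.
Proof.
have [[u u0 defP] [v _ defQ]] := (vector_of_point P, vector_of_point Q).
move=> PQ; rewrite defP defQ dim_add_vlines //.
by apply: contra PQ => uv; apply/eqP/esym/flat_eq; rewrite defP defQ -memvE.
Qed.

Lemma line_through (F : finFieldType) (P Q : pg_point F) :
  P != Q -> exists2 l : pg_line F, P \in line_points l & Q \in line_points l.
Proof.
by move=> PQ; exists (PGFlat (dim_join PQ)); rewrite inE /= ?addvSl ?addvSr.
Qed.

Lemma line_unique (F : finFieldType) (P Q : pg_point F) (l m : pg_line F) :
  P != Q -> P \in line_points l -> Q \in line_points l ->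
  P \in line_points m -> Q \in line_points m -> l = m.
Proof.
move=> PQ; rewrite !inE => Pl Ql Pm Qm.
transitivity (PGFlat (dim_join PQ)); first apply/esym;
  by apply: flat_eq; rewrite /= subv_add; apply/andP.
Qed.

Lemma lines_meet (F : finFieldType) (l m : pg_line F) :
  exists P : pg_point F, (P \in line_points l) && (P \in line_points m).
Proof.
have : (l :&: m)%VS != 0%VS.
  rewrite -dimv_eq0 -lt0n; have := dimv_sum_cap l m.
  rewrite (eqP (flat_dim l)) (eqP (flat_dim m)).
  have : (\dim (l + m)%VS <= 3)%N.
    by rewrite (leq_trans (dimvS (subvf _))) // dimvf.
  lia.
rewrite -vpick0 => /point_of_vector[P defP]; exists P.
by rewrite !inE defP -!memvE -memv_cap memv_pick.
Qed.

Definition meet (F : finFieldType) (l m : pg_line F) : pg_point F :=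
  xchoose (lines_meet l m).

Lemma meet_left (F : finFieldType) (l m : pg_line F) :
  meet l m \in line_points l.
Proof. by have /andP[] := xchooseP (lines_meet l m). Qed.

Lemma meet_right (F : finFieldType) (l m : pg_line F) :
  meet l m \in line_points m.
Proof. by have /andP[] := xchooseP (lines_meet l m). Qed.

Lemma meet_unique (F : finFieldType) (l m : pg_line F) (P : pg_point F) :
  l != m -> P \in line_points l -> P \in line_points m -> P = meet l m.
Proof.
move=> lm Pl Pm; apply/eqP; apply: contraR lm => PQ; apply/eqP.
by apply: line_unique PQ _ _ _ _ => //; rewrite ?meet_left ?meet_right.
Qed.

Lemma independent_span (F : finFieldType) (U : {vspace 'rV[F]_3}) :
  \dim U = 2 -> exists u v : 'rV[F]_3,
    [/\ u != 0, v \notin <[u]>%VS & U = (<[u]> + <[v]>)%VS].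
Proof.
move=> dU; have u0 : vpick U != 0 by rewrite vpick0 -dimv_eq0 dU.
have /subvPn[v vU vu] : ~~ (U <= <[vpick U]>)%VS.
  by apply/negP => /dimvS; rewrite dU dim_vline u0.
exists (vpick U), v; split => //; apply/eqP; rewrite eq_sym.
rewrite -(dimv_leqif_eq (_ : _ <= U)%VS) ?dU ?dim_add_vlines //.
by rewrite subv_add -!memvE memv_pick.
Qed.

Lemma independent_coef (F : finFieldType) (u v : 'rV[F]_3) (a b : F) :
  u != 0 -> v \notin <[u]>%VS -> a *: u + b *: v = 0 -> a = 0 /\ b = 0.
Proof.
move=> u0 uv eq0; have b0 : b = 0.
  apply/eqP; apply: contraR uv => b0; apply/vlineP; exists (- (b^-1 * a)).
  apply: (scalerI b0); rewrite scalerA mulrN mulVKf // scaleNr.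
  by apply/eqP; rewrite -addr_eq0 addrC eq0.
move: eq0; rewrite b0 scale0r addr0 => /eqP; rewrite scaler_eq0 (negPf u0) orbF.
by move/eqP.
Qed.

(** For a line spanned by u and v, the points are <u> and, for c in F,
    <c u + v>. *)
Lemma card_line_points (F : finFieldType) (l : pg_line F) :
  #|line_points l| = #|F|.+1.
Proof.
have [u [v [u0 vu eql]]] := independent_span (eqP (flat_dim l)).
have [P0 eqP0] := point_of_vector u0.
have v0 (c : F) : c *: u + v != 0.
  apply: contra vu; rewrite addrC addr_eq0 => /eqP ->.
  by rewrite memvN memvZ ?memv_line.
pose f (o : option F) : pg_point F :=
  if o is Some c then insubd P0 <[c *: u + v]>%VS else P0.
have fS c : flat_space (f (Some c)) = <[c *: u + v]>%VS.
  by apply: insubdK; rewrite /= -topredE /= dim_vline v0.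
have inj_f : injective f.
  move=> [c|] [c'|] //.
  - move/(congr1 (@flat_space F 1)); rewrite !fS => eqS.
    have /vlineP[k eqk] : c *: u + v \in <[c' *: u + v]>%VS.
      by rewrite -eqS memv_line.
    have [|h1 h2] := @independent_coef F u v (c - k * c') (1 - k) u0 vu.
      rewrite !scalerBl scale1r addrACA eqk scalerDr scalerA.
      by rewrite -opprD subrr.
    by move: h1; rewrite -(subr0_eq h2) mul1r => /subr0_eq ->.
  - move/(congr1 (@flat_space F 1)); rewrite fS eqP0 => eqS.
    case/negP: vu; rewrite -[v](addKr (c *: u)) memvD //.
      by rewrite memvN memvZ ?memv_line.
    by rewrite -eqS memv_line.
  - move/(congr1 (@flat_space F 1)); rewrite fS eqP0 => eqS.
    case/negP: vu; rewrite -[v](addKr (c' *: u)) memvD //.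
      by rewrite memvN memvZ ?memv_line.
    by rewrite eqS memv_line.
suff -> : line_points l = f @: setT.
  by rewrite card_imset // cardsT card_option.
apply/setP => P; rewrite inE; apply/idP/imsetP => [Pl|[[c|] _ ->]]; last first.
- by rewrite eqP0 eql addvSl.
- by rewrite fS eql -memvE memv_add ?memvZ ?memv_line.
have [w w0 defP] := vector_of_point P.
have : w \in (<[u]> + <[v]>)%VS by rewrite -eql; move: Pl; rewrite defP -memvE.
case/memv_addP => _ /vlineP[a ->] [_ /vlineP[b ->] eqw].
have [b0|b0] := eqVneq b 0.
  exists None => //; apply: flat_eq; rewrite defP eqP0 -memvE eqw b0 scale0r.
  by rewrite addr0 memvZ ?memv_line.
exists (Some (b^-1 * a)) => //; apply: flat_eq; rewrite defP fS -memvE.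
apply/vlineP; exists b; by rewrite eqw scalerDr scalerA mulVKf.
Qed.

Definition lines_through (F : finFieldType) (P : pg_point F) :
    {set pg_line F} :=
  [set l | P \in line_points l].

Lemma mem_lines_through (F : finFieldType) (P : pg_point F) (l : pg_line F) :
  (l \in lines_through P) = (P \in line_points l).
Proof. by rewrite inE. Qed.

Lemma exists_line_avoiding (F : finFieldType) (P : pg_point F) :
  exists l : pg_line F, (P :&: l)%VS = 0%VS.
Proof.
have dl : \dim (P^C)%VS == 2 by rewrite dimv_compl dimvf (eqP (flat_dim P)).
by exists (PGFlat dl); rewrite /= capv_compl.
Qed.

(** The lines through P correspond to their points of intersection with a line
    that avoids P. *)
Lemma card_lines_through (F : finFieldType) (P : pg_point F) :
  #|lines_through P| = #|F|.+1.
Proof.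
have [l0 Pl0] := exists_line_avoiding P.
have {}Pl0 : P \notin line_points l0.
  rewrite inE; apply/negP => /capv_idPl; rewrite Pl0 => P0.
  by have := flat_dim P; rewrite -P0 dimv0.
rewrite -(card_line_points l0).
have neq l : l \in lines_through P -> P != meet l l0.
  by move=> _; apply: contra Pl0 => /eqP ->; apply: meet_right.
rewrite -(@card_in_imset _ _ (fun l => meet l l0)) => [|l m Pl Pm eq_lm].
  apply: eq_card => Q; apply/imsetP/idP => [[l _ ->]|Ql0].
    exact: meet_right.
  have PQ : P != Q by apply: contra Pl0 => /eqP ->.
  have [l Pl Ql] := line_through PQ; exists l.
    by rewrite mem_lines_through.
  apply: meet_unique => //; by apply: contra Pl0 => /eqP <-.
have := neq l Pl; move: Pl Pm; rewrite !mem_lines_through => Pl Pm PQ.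
apply: line_unique PQ _ _ _ _ => //; first by rewrite meet_left.
by rewrite eq_lm meet_left.
Qed.

(** Affine coordinates on the lines that avoid P.  For P = <e> and u, v spanning
    a complement of P, such a line contains u + s e and v + t e for unique s and
    t; its coordinates are (s, t).  The lines with coordinates (s, t) and
    (s', t') meet in the vector a u + b v + r e with (a : b) orthogonal to
    (s - s', t - t'), so the direction of the difference determines the common
    point. *)
Lemma affine_chart (F : finFieldType) (P : pg_point F) :
  exists co : pg_line F -> F * F,
    {in [pred l | l \notin lines_through P] &, injective co} /\
    {in [pred l | l \notin lines_through P] & &, forall l m m' c, l != m ->
      (co l).1 - (co m).1 = c * ((co l).1 - (co m').1) ->
      (co l).2 - (co m).2 = c * ((co l).2 - (co m').2) ->
      exists Q : pg_point F,
        [/\ Q \in line_points l, Q \in line_points m & Q \in line_points m']}.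
Proof.
have [e e0 defP] := vector_of_point P.
have [l0 Pl0] := exists_line_avoiding P.
have [u [v [u0 vu eql0]]] := independent_span (eqP (flat_dim l0)).
have indep a b s : a *: u + b *: v + s *: e = 0 -> a = 0 /\ b = 0.
  move=> eq0; apply: (independent_coef u0 vu); apply/eqP.
  rewrite -memv0 -Pl0 memv_cap eql0 memv_add ?memvZ ?memv_line // andbT.
  move/eqP: eq0; rewrite addr_eq0 => /eqP ->.
  by rewrite defP memvN memvZ ?memv_line.
have meets (l : pg_line F) (w : 'rV[F]_3) : l \notin lines_through P ->
    exists s, w + s *: e \in flat_space l.
  rewrite !inE => Pl; suff : w \in (P + l)%VS.
    rewrite defP => /memv_addP[_ /vlineP[k ->] [x xl ->]]; exists (- k).
    by rewrite addrAC scaleNr subrr add0r.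
  suff -> : (P + l)%VS = fullv by rewrite memvf.
  apply/eqP; rewrite -(dimv_leqif_eq (subvf _)) dimvf.
  have : ((P + l)%VS != l)%VS.
    by apply: contra Pl => /eqP <-; rewrite addvSl.
  rewrite eq_sym -(dimv_leqif_eq (addvSr _ _)) (eqP (flat_dim l)).
  have := dimvS (addvSr P l); rewrite (eqP (flat_dim l)).
  have := dimvS (subvf (P + l)%VS); rewrite dimvf /dim /=; lia.
pose coef (w : 'rV[F]_3) (l : pg_line F) : F :=
  odflt 0 [pick s | w + s *: e \in flat_space l].
have coefP w l : l \notin lines_through P -> w + coef w l *: e \in flat_space l.
  move=> Pl; rewrite /coef; case: pickP => //= no.
  by have [s] := meets l w Pl; rewrite no.
have inj_co : {in [pred l | l \notin lines_through P] &,
    injective (fun l => (coef u l, coef v l))}.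
  move=> l m Pl Pm [eu ev].
  have [ul vl] := (coefP u l Pl, coefP v l Pl).
  have [um vm] := (coefP u m Pm, coefP v m Pm).
  rewrite -eu -ev in um vm.
  set x := u + _ in ul um; set y := v + _ in vl vm.
  have x0 : x != 0.
    apply/eqP => x0; have [|/eqP] := indep 1 0 (coef u l).
      by rewrite scale1r scale0r addr0.
    by rewrite oner_eq0.
  have xy : y \notin <[x]>%VS.
    apply/negP => /vlineP[k eqk].
    have [|_ /eqP] := indep (- k) 1 (coef v l - k * coef u l).
      have : y - k *: x = 0 by rewrite eqk subrr.
      move <-; rewrite /x /y; apply/rowP => i; rewrite !mxE; ring.
    by rewrite oner_eq0.
  have dl : \dim (<[x]> + <[y]>)%VS == 2 by rewrite dim_add_vlines.
  transitivity (PGFlat dl); first apply/esym; apply: flat_eq => /=;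
    by rewrite subv_add -!memvE; apply/andP.
exists (fun l => (coef u l, coef v l)); split => // l m m' Pl Pm Pm' c lm /=.
set s := coef u l; set t := coef v l.
set s1 := coef u m; set t1 := coef v m; set s2 := coef u m'; set t2 := coef v m'.
move=> eqs eqt.
(* A vector common to the lines with coordinates (s, t) and (s', t'). *)
pose z (s' t' : F) := (t - t') *: u - (s - s') *: v + (s' * t - s * t') *: e.
have z_in m0 : m0 \notin lines_through P ->
    z (coef u m0) (coef v m0) \in flat_space m0.
  move=> Pm0; set s' := coef u m0; set t' := coef v m0.
  have -> : z s' t' = (t - t') *: (u + s' *: e) - (s - s') *: (v + t' *: e).
    by rewrite /z; apply/rowP => i; rewrite !mxE; ring.
  by rewrite memvB ?memvZ ?coefP.
have z_inl s' t' : z s' t' \in flat_space l.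
  have -> : z s' t' = (t - t') *: (u + s *: e) - (s - s') *: (v + t *: e).
    by rewrite /z; apply/rowP => i; rewrite !mxE; ring.
  by rewrite memvB ?memvZ ?coefP.
have eqz : z s1 t1 = c *: z s2 t2.
  have -> : s1 = s - c * (s - s2) by rewrite -eqs subKr.
  have -> : t1 = t - c * (t - t2) by rewrite -eqt subKr.
  by rewrite /z; apply/rowP => i; rewrite !mxE; ring.
have z0 : z s1 t1 != 0.
  apply: contra lm => /eqP; rewrite /z -scaleNr => /indep[t0 s0].
  apply/eqP/inj_co => //; congr pair; apply/subr0_eq => //.
  by apply: oppr_inj; rewrite s0 oppr0.
have [Q defQ] := point_of_vector z0; exists Q.
rewrite !inE defQ -!memvE z_inl {2}eqz memvZ ?z_in //; split=> //; exact: z_in.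
Qed.

Local Close Scope ring_scope.

(** * Maximal arcs *)

(** The lines through P partition the other points. *)
Lemma card_by_pencil (F : finFieldType) (P : pg_point F) (S : {set pg_point F}) :
  P \notin S -> #|S| = \sum_(l in lines_through P) #|line_points l :&: S|.
Proof.
move=> PS.
under eq_bigr => l _ do rewrite setIC -sum1_card.
under eq_bigr => l _ do under eq_bigl => Q do rewrite inE.
rewrite (exchange_big_dep (mem S)) /=; last by move=> l Q _ /andP[].
rewrite -sum1_card; apply: eq_bigr => Q QS.
have PQ : P != Q by apply: contraNneq PS => ->.
have [l Pl Ql] := line_through PQ.
rewrite (big_pred1 l) // => m /=; rewrite mem_lines_through QS /=.
apply/andP/eqP => [[Pm Qm]|-> //]; exact: line_unique PQ _ _ _ _.
Qed.

Definition block (F : finFieldType) (A : {set pg_point F}) (l : pg_line F) :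
    {set pg_point F} := line_points l :&: A.

Definition external_lines (F : finFieldType) (A : {set pg_point F}) :
    {set pg_line F} := [set l | block A l == set0].

Lemma external_disjoint (F : finFieldType) (A : {set pg_point F})
    (e : pg_line F) (Q : pg_point F) :
  e \in external_lines A -> Q \in line_points e -> Q \notin A.
Proof.
rewrite inE => /eqP/setP/(_ Q) + Qe.
by rewrite inE Qe inE /= => ->.
Qed.

(** The q + 1 lines through P partition the (q + 1) (d - 1) other points of A
    and contain at most d - 1 of them each, so each contains exactly d - 1. *)
Lemma maximal_arc_secant (F : finFieldType) (A : {set pg_point F}) (n d : nat)
    (P : pg_point F) (l : pg_line F) :
  is_maximal_arc A n d -> P \in A -> P \in line_points l -> is_secant A d l.
Proof.
move=> [[n1 d1 cardA le_d _] eq_n] PA Pl.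
have blockD1 m : m \in lines_through P ->
    #|block A m| = #|line_points m :&: (A :\ P)|.+1.
  rewrite mem_lines_through => Pm; rewrite (cardsD1 P) inE Pm PA add1n.
  by rewrite setIDA.
have le_d1 m : m \in lines_through P ->
    #|line_points m :&: (A :\ P)| <= d.-1 ?= iff is_secant A d m.
  move=> /blockD1 eqb; split; last first.
    by rewrite /is_secant -/(block A m) eqb -[in RHS](prednK (ltnW d1)).
  by rewrite -ltnS -eqb prednK ?le_d // ltnW.
have [_] := leqif_sum le_d1.
rewrite -card_by_pencil ?inE ?eqxx // sum_nat_const card_lines_through.
have -> : #|A :\ P| = #|F|.+1 * d.-1.
  by have := cardsD1 P A; rewrite PA cardA eq_n -subn1 !addn1 => /addnI <-.
rewrite eqxx => /esym/forallP/(_ l).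
by rewrite mem_lines_through Pl.
Qed.

(** If t of the lines through P are external, the other ones partition A into
    q + 1 - t sets of size d, so that (q + 1 - t) d = #|A| = (q + 1) d - q. *)
Lemma card_external_through (F : finFieldType) (A : {set pg_point F})
    (n d : nat) (P : pg_point F) :
  is_maximal_arc A n d -> P \notin A ->
  #|lines_through P :&: external_lines A| * d = #|F|.
Proof.
move=> hA PA; have [[n1 d1 cardA _ _] eq_n] := hA.
have := card_by_pencil PA; have := card_lines_through P.
rewrite (bigID (mem (external_lines A))) /=.
rewrite -(cardsID (external_lines A) (lines_through P)).
rewrite big1 => [|l /andP[_]]; last first.
  by rewrite inE => /eqP; rewrite /block => ->; rewrite cards0.
rewrite (eq_bigr (fun=> d)) => [|l /andP[_]]; last first.
  rewrite inE => /set0Pn[Q]; rewrite inE => /andP[Ql QA].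
  exact/eqP/(maximal_arc_secant hA QA Ql).
rewrite (eq_bigl (mem (lines_through P :\: external_lines A))) => [|l]; last first.
  by rewrite !inE andbC.
rewrite sum_nat_const cardA eq_n.
move: #|_ :\: _| #|_ :&: _| => s t.
case: d d1 {hA eq_n} => // d _ /(congr1 (muln^~ d.+1)).
by rewrite mulnDl subSS subn0; move: #|F| => q; nia.
Qed.

Lemma block_inj (F : finFieldType) (A : {set pg_point F}) (d : nat) :
  1 < d -> {in is_secant A d &, injective (block A)}.
Proof.
move=> d1 l m /eqP ld _ eq_lm; have := d1; rewrite -ld.
case/card_gt1P => P [Q [Pl Ql PQ]]; have := (Pl, Ql); rewrite -/(block A l) eq_lm.
move: Pl Ql; rewrite !inE => /andP[Pl _] /andP[Ql _].
case=> /andP[Pm _] /andP[Qm _]; apply: line_unique PQ _ _ _ _; by rewrite ?inE.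
Qed.

(** * Secants meeting pairwise inside the arc *)

Definition meet_in (F : finFieldType) (A : {set pg_point F})
    (W : {set pg_line F}) : Prop :=
  {in W &, forall l m, l != m -> meet l m \in A}.

(** Passing from blocks to secants loses nothing: a block has at least two
    points, hence determines its secant. *)
Lemma intersecting_family_lines (F : finFieldType) (A : {set pg_point F})
    (d : nat) (Y : {set {set pg_point F}}) :
  1 < d -> intersecting_family (arc_blocks A d) Y ->
  exists W : {set pg_line F},
    [/\ {in W, forall l, is_secant A d l}, meet_in A W, #|W| = #|Y|
      & Y = block A @: W].
Proof.
move=> d1 [/subsetP YD intY].
pose W := [set l | is_secant A d l & block A l \in Y].
have secW : {in W, forall l, is_secant A d l} by move=> l; rewrite inE => /andP[].
have injW : {in W &, injective (block A)}.
  by move=> l m /secW ld /secW md; apply: (block_inj d1).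
have defY : Y = block A @: W.
  apply/setP => B; apply/idP/imsetP => [YB|[l]]; last first.
    by rewrite inE => /andP[_ YB] ->.
  have /imsetP[l] := YD B YB; rewrite inE => ld defB.
  by exists l => //; rewrite inE [is_secant _ _ _]ld /block -defB.
exists W; split => //; last by rewrite defY card_in_imset.
move=> l m Wl Wm lm; have neq : block A l != block A m.
  by apply: contra lm => /eqP/injW->.
have [Yl Ym] : block A l \in Y /\ block A m \in Y.
  by rewrite defY !imset_f.
have /eqP/cards1P[Q defQ] := intY _ _ Yl Ym neq.
have : Q \in block A l :&: block A m by rewrite defQ inE.
rewrite !in_setI => /andP[/andP[Ql QA] /andP[Qm _]].
by rewrite -(meet_unique lm Ql Qm).
Qed.

(** Two lines of W meeting e in the same point would meet each other there,
    outside A. *)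
Lemma meet_external_inj (F : finFieldType) (A : {set pg_point F})
    (W : {set pg_line F}) (e : pg_line F) :
  meet_in A W -> e \in external_lines A -> {in W &, injective (meet e)}.
Proof.
move=> meetW ext_e l m Wl Wm eq_meet; apply/eqP/negP => /negP lm.
have /negP[] := external_disjoint ext_e (meet_left e l).
by rewrite (meet_unique lm (meet_right e l)) ?meetW // eq_meet meet_right.
Qed.

Lemma meet_in_card (F : finFieldType) (A : {set pg_point F})
    (W : {set pg_line F}) (e : pg_line F) :
  meet_in A W -> e \in external_lines A -> #|W| <= #|F|.+1.
Proof.
move=> meetW ext_e; rewrite -(card_line_points e).
rewrite -(card_in_imset (meet_external_inj meetW ext_e)) subset_leq_card //.
by apply/subsetP => _ /imsetP[l _ ->]; apply: meet_left.
Qed.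

Lemma meet_in_cover (F : finFieldType) (A : {set pg_point F})
    (W : {set pg_line F}) (e : pg_line F) (P : pg_point F) :
  meet_in A W -> #|W| = #|F|.+1 -> e \in external_lines A ->
  P \in line_points e -> exists2 l, l \in W & P \in line_points l.
Proof.
move=> meetW cardW ext_e Pe.
have im_meet : meet e @: W = line_points e.
  apply/eqP; rewrite eqEcard card_line_points.
  rewrite (card_in_imset (meet_external_inj meetW ext_e)) cardW leqnn andbT.
  by apply/subsetP => _ /imsetP[l _ ->]; apply: meet_left.
move: Pe; rewrite -im_meet => /imsetP[l Wl ->].
by exists l => //; apply: meet_right.
Qed.

(** Let x be a line through the meet of l and m.  If x is not in W, the q + 1
    lines of W cover the q + 1 points of x by one point each, hence cover each
    point once; but l and m cover the same point.  So W contains the pencil,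
    which has as many lines as W. *)
Lemma covering_pencil (F : finFieldType) (W : {set pg_line F}) (l m : pg_line F) :
  #|W| = #|F|.+1 -> l \in W -> m \in W -> l != m ->
  (forall P, exists2 k, k \in W & P \in line_points k) ->
  W = lines_through (meet l m).
Proof.
move=> cardW Wl Wm lm cover; apply/esym/eqP.
rewrite eqEcard card_lines_through cardW leqnn andbT.
apply/subsetP => x; rewrite mem_lines_through => Px; apply: contraNT lm => Wx.
have neqx k : k \in W -> x != k by apply: contraTneq => <-.
have im_meet : meet x @: W = line_points x.
  apply/setP => Q; apply/imsetP/idP => [[k _ ->]|Qx]; first exact: meet_left.
  have [k Wk Qk] := cover Q; exists k => //.
  exact: meet_unique (neqx k Wk) Qx Qk.
have /imset_injP inj_meet : #|meet x @: W| == #|W|.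
  by rewrite im_meet card_line_points cardW.
apply/eqP/inj_meet => //.
rewrite -(meet_unique (neqx l Wl) Px (meet_left l m)).
exact: meet_unique (neqx m Wm) Px (meet_right l m).
Qed.

(** In the affine plane of lines avoiding P, the external lines are nuclei of W:
    if the differences from an external line e to two lines of W are parallel,
    these lines meet e in the same point.  External lines do avoid P since all
    their points are covered by W. *)
Lemma meet_in_avoiding (F : finFieldType) (A : {set pg_point F})
    (W : {set pg_line F}) (P : pg_point F) :
  meet_in A W -> #|W| = #|F|.+1 -> [disjoint W & external_lines A] ->
  (forall l, l \in W -> P \notin line_points l) ->
  #|external_lines A| < #|F|.
Proof.
move=> meetW cardW disjW avoidW.
have [co [inj_co co_meet]] := affine_chart P.
have avoidE e : e \in external_lines A -> e \notin lines_through P.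
  move=> ext_e; rewrite mem_lines_through; apply/negP => Pe.
  have [l Wl Pl] := meet_in_cover meetW cardW ext_e Pe.
  by rewrite (negPf (avoidW l Wl)) in Pl.
have {}avoidW l : l \in W -> l \notin lines_through P.
  by rewrite mem_lines_through; apply: avoidW.
have neq e l : e \in external_lines A -> l \in W -> e != l.
  move=> ext_e; apply: contraTneq => <-.
  by rewrite (disjointFl disjW ext_e).
rewrite -(@card_in_imset _ _ co) => [|e e' ext_e ext_e']; last first.
  by apply: inj_co; apply: avoidE.
apply: (@card_nuclei F (co @: W)).
  rewrite card_in_imset // => l m Wl Wm.
  by apply: inj_co; apply: avoidW.
move=> _ /imsetP[e ext_e ->]; split.
  apply/imsetP => -[l Wl /inj_co eq_el].
  by have /eqP[] := neq e l ext_e Wl; apply: eq_el; [apply: avoidE | apply: avoidW].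
move=> _ _ /imsetP[l Wl ->] /imsetP[m Wm ->] c eq1 eq2.
have [Q [Qe Ql Qm]] := co_meet e l m (avoidE e ext_e) (avoidW l Wl)
  (avoidW m Wm) c (neq e l ext_e Wl) eq1 eq2.
have [-> //|lm] := eqVneq l m.
have /negP[] := external_disjoint ext_e Qe.
by rewrite (meet_unique lm Ql Qm) meetW.
Qed.

Lemma exists_external_through (F : finFieldType) (A : {set pg_point F})
    (n d : nat) (P : pg_point F) :
  is_maximal_arc A n d -> P \notin A ->
  exists2 e, e \in external_lines A & P \in line_points e.
Proof.
move=> hA PA; have := card_external_through hA PA.
have [->|] := set_0Vmem (lines_through P :&: external_lines A).
  by rewrite cards0 => F0; have := finNzRing_gt1 F; rewrite -F0.
case=> e; rewrite in_setI mem_lines_through => /andP[Pe ext_e] _.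
by exists e.
Qed.

(** Since d <= q, a secant has a point outside A. *)
Lemma exists_external (F : finFieldType) (A : {set pg_point F}) (n d : nat) :
  is_maximal_arc A n d -> d <> #|F|.+1 -> exists e, e \in external_lines A.
Proof.
move=> hA dq; have [[_ _ _ _ [l ld]] _] := hA.
have /subsetPn[P Pl PA] : ~~ (line_points l \subset A).
  by apply/negP => /setIidPl lA; case: dq; rewrite -ld lA card_line_points.
by have [e] := exists_external_through hA PA; exists e.
Qed.

(** Each of the q + 1 points of an external line e is the meet of e with another
    external line, since it lies on q / d >= 2 of them. *)
Lemma card_external_lines (F : finFieldType) (A : {set pg_point F}) (n d : nat) :
  is_maximal_arc A n d -> d <> #|F|.+1 -> d <> #|F| ->
  #|F| < #|external_lines A|.
Proof.
move=> hA dq1 dq; have [e ext_e] := exists_external hA dq1.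
rewrite -(card_line_points e).
apply: leq_trans (leq_imset_card (meet e) (external_lines A)).
rewrite subset_leq_card //; apply/subsetP => P Pe.
have PA := external_disjoint ext_e Pe.
have : 1 < #|lines_through P :&: external_lines A|.
  have := card_external_through hA PA; have := finNzRing_gt1 F.
  by case: #|_ :&: _| => [|[|t]] //; [case: #|F| | rewrite mul1n].
rewrite (cardsD1 e) in_setI mem_lines_through Pe ext_e ltnS => /card_gt0P[e'].
rewrite in_setD1 in_setI mem_lines_through => /and3P[e'e Pe' ext_e'].
by apply/imsetP; exists e' => //; apply: meet_unique; rewrite // eq_sym.
Qed.

Lemma maximum_meet_in_pencil (F : finFieldType) (A : {set pg_point F})
    (n d : nat) (W : {set pg_line F}) :
  is_maximal_arc A n d -> d <> #|F|.+1 -> d <> #|F| ->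
  {in W, forall l, is_secant A d l} -> meet_in A W -> #|W| = #|F|.+1 ->
  exists2 P, P \in A & W = lines_through P.
Proof.
move=> hA dq1 dq secW meetW cardW; have [[_ d1 _ _ _] _] := hA.
have /card_gt1P[l [m [Wl Wm lm]]] : 1 < #|W|.
  by rewrite cardW ltnS ltnW ?finNzRing_gt1.
exists (meet l m); first exact: meetW.
apply: covering_pencil => // P.
have [/existsP[k /andP[]]|] := boolP [exists k, (k \in W) && (P \in line_points k)].
  by exists k.
rewrite negb_exists => /forallP avoid.
have := ltn_trans (card_external_lines hA dq1 dq) (meet_in_avoiding meetW cardW _ _).
rewrite ltnn => contra; suff: false by []. apply: (contra P).
  apply/pred0P => k /=; apply/negP => /andP[/secW/eqP kd].
  by rewrite inE => /eqP k0; move: d1; rewrite -kd -/(block A k) k0 cards0.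
by move=> k Wk; have := avoid k; rewrite Wk.
Qed.

(** * Canonical intersecting families *)

Lemma blocks_through_lines (F : finFieldType) (A : {set pg_point F}) (n d : nat)
    (P : pg_point F) :
  is_maximal_arc A n d -> P \in A ->
  blocks_through (arc_blocks A d) P = block A @: lines_through P.
Proof.
move=> hA PA; apply/setP => B; rewrite inE; apply/andP/imsetP.
  case=> /imsetP[l _ ->]; rewrite inE => /andP[Pl _].
  by exists l; rewrite ?mem_lines_through.
case=> l; rewrite mem_lines_through => Pl ->; split; last by rewrite inE Pl.
by apply: imset_f; rewrite inE; apply: maximal_arc_secant hA PA Pl.
Qed.

Lemma card_blocks_through (F : finFieldType) (A : {set pg_point F}) (n d : nat)
    (P : pg_point F) :
  is_maximal_arc A n d -> P \in A ->
  #|blocks_through (arc_blocks A d) P| = #|F|.+1.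
Proof.
move=> hA PA; have [[_ d1 _ _ _] _] := hA.
rewrite (blocks_through_lines hA PA) card_in_imset ?card_lines_through //.
move=> l m; rewrite !mem_lines_through => Pl Pm.
by apply: (block_inj d1); apply: maximal_arc_secant hA PA _.
Qed.

Lemma intersecting_blocks_through (F : finFieldType) (A : {set pg_point F})
    (n d : nat) (P : pg_point F) :
  is_maximal_arc A n d -> P \in A ->
  intersecting_family (arc_blocks A d) (blocks_through (arc_blocks A d) P).
Proof.
move=> hA PA; split; first by apply/subsetP => B; rewrite inE => /andP[].
move=> B C; rewrite (blocks_through_lines hA PA).
move=> /imsetP[l + ->] /imsetP[m + ->]; rewrite !mem_lines_through => Pl Pm neq.
have lm : l != m by apply: contraNneq neq => ->.
apply/eqP/cards1P; exists P; apply/setP => Q; rewrite !in_setI in_set1.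
apply/idP/eqP => [/andP[/andP[Ql _] /andP[Qm _]]|->]; last by rewrite Pl Pm PA.
by rewrite (meet_unique lm Ql Qm) -(meet_unique lm Pl Pm).
Qed.

Theorem theorem2 (F : finFieldType) (q n d : nat) (A : {set pg_point F})
    (hq : #|F| = q) (hA : is_maximal_arc A n d) (hd : d <> q + 1) :
  (forall P : pg_point F, P \in A ->
     maximum_intersecting_family (arc_blocks A d)
       (blocks_through (arc_blocks A d) P)) /\
  (d <> q ->
   forall Y : {set {set pg_point F}},
     maximum_intersecting_family (arc_blocks A d) Y <->
     exists2 P : pg_point F, P \in A & Y = blocks_through (arc_blocks A d) P).
Proof.
subst q; rewrite addn1 in hd.
have [[n1 d1 cardA _ _] _] := hA.
have [e ext_e] := exists_external hA hd.
have maxP P : P \in A -> maximum_intersecting_family (arc_blocks A d)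
    (blocks_through (arc_blocks A d) P).
  move=> PA; split; first exact: intersecting_blocks_through hA PA.
  move=> Z /(intersecting_family_lines d1)[W [_ meetW <- _]].
  by rewrite (card_blocks_through hA PA); apply: meet_in_card meetW ext_e.
split=> // dq Y; split=> [[intY maxY]|[P PA ->]]; last exact: maxP.
have [W [secW meetW cardW defY]] := intersecting_family_lines d1 intY.
have /card_gt0P[P0 P0A] : 0 < #|A| by rewrite cardA ltnW.
have {}cardW : #|W| = #|F|.+1.
  apply/eqP; rewrite eqn_leq (meet_in_card meetW ext_e) cardW.
  rewrite -(card_blocks_through hA P0A) maxY //.
  exact: intersecting_blocks_through hA P0A.
have [P PA defW] := maximum_meet_in_pencil hA hd dq secW meetW cardW.
by exists P => //; rewrite defY defW (blocks_through_lines hA PA).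
Qed.
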